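(* Let $Q,B$ be $n\times n$ real matrices satisfying the standing assumptions, and let $V(t)=\det Q(t)$. Suppose that $\operatorname{Rank}(Q)<n$ and that $B$ is similar to a (real) skew-symmetric matrix. Then there exists $\gamma>0$ such that $$V(t)=\gamma\,t^{n}+O(t^{n-1})\qquad\text{as }t\to\infty.$$
   Context: Standing assumptions. $n\ge2$; $Q,B$ are constant real $n\times n$ matrices, $Q=Q^\star\ge0$ ($^\star$ is transpose). $\operatorname{Ker}Q$ contains no nontrivial invariant subspace of $B^\star$; equivalently the Gramian $Q(t)=\int_0^te^{sB}Qe^{sB^\star}ds$ is positive definite for every $t>0$. Moreover $Q,B$ are in canonical form: $Q=\begin{pmatrix}Q_0&0\\0&0\end{pmatrix}$ with $Q_0=Q_0^\star>0$ of size $p_0\times p_0$, and with respect to the block partition $n=p_0+p_1+\dots+p_\nu$, $p_0\ge p_1\ge\dots\ge p_\nu\ge1$, the matrix $B$ has subdiagonal blocks $B_1,\dots,B_\nu$, where $B_j$ is $p_j\times p_{j-1}$ of rank $p_j$ (in block position row $j$, column $j-1$, blocks numbered from $0$), all blocks strictly below the subdiagonal are zero, and all blocks on or above the diagonal are arbitrary. *)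

(* Defs.v *)
From HB Require Import structures.
From mathcomp Require Import all_boot all_order all_algebra.
From mathcomp Require Import all_classical all_reals all_analysis.

Set Implicit Arguments.
Unset Strict Implicit.
Unset Printing Implicit Defensive.

Import Order.TTheory GRing.Theory Num.Theory.
Import numFieldNormedType.Exports.

Local Open Scope classical_set_scope.
Local Open Scope ring_scope.

Definition psdmx (R : realType) (n : nat) (A : 'M[R]_n) : Prop :=
  A^T = A /\ forall x : 'cV[R]_n, 0 <= (x^T *m A *m x) 0 0.

Definition posdefmx (R : realType) (n : nat) (A : 'M[R]_n) : Prop :=
  A^T = A /\ forall x : 'cV[R]_n, x != 0 -> 0 < (x^T *m A *m x) 0 0.

(* "Ker Q contains no nontrivial invariant subspace of B^T", where
   "nontrivial" means different from {0}. *)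
Definition ker_no_invariant (R : realType) (n : nat) (Q B : 'M[R]_n) : Prop :=
  forall W : {vspace 'cV[R]_n},
    (forall x, x \in W -> Q *m x = 0) ->
    (forall x, x \in W -> B^T *m x \in W) ->
    W = 0%VS.

(* Block (i, j), numbered from 0, with respect to the partition
   n = p 0 + ... + p nu; the cast along e makes the partition visible in the
   type of A. *)
Definition mxblk (R : realType) (n nu : nat) (p : 'I_nu.+1 -> nat)
    (e : n = (\sum_k p k)%N) (A : 'M[R]_n) (i j : 'I_nu.+1) : 'M[R]_(p i, p j) :=
  submxblock (castmx (e, e) A) i j.

Record canonical_form (R : realType) (n nu : nat) (p : 'I_nu.+1 -> nat)
    (e : n = (\sum_k p k)%N) (Q B : 'M[R]_n) : Prop := CanonicalForm {
  cf_size_gt0 : forall j, (1 <= p j)%N;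
  cf_size_noninc : forall i j : 'I_nu.+1, (i <= j)%N -> (p j <= p i)%N;
  cf_Q00 : posdefmx (mxblk e Q ord0 ord0);
  cf_Q0 : forall i j : 'I_nu.+1,
    ~~ ((i == ord0) && (j == ord0)) -> mxblk e Q i j = 0;
  cf_B_subdiag : forall i j : 'I_nu.+1,
    i = j.+1 :> nat -> \rank (mxblk e B i j) = p i;
  cf_B_below : forall i j : 'I_nu.+1, (j.+1 < i)%N -> mxblk e B i j = 0
}.

(* The limit is for the (entrywise) topology of matrices. *)
Definition expmx (R : realType) (n : nat) (A : 'M[R]_n) : 'M[R]_n :=
  limn (series (fun k : nat => (k`!%:R)^-1 *: A ^+ k)).

Definition gramian (R : realType) (n : nat) (Q B : 'M[R]_n) (t : R) : 'M[R]_n :=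
  \matrix_(i, j) \int[@lebesgue_measure R]_(s in `[0, t])
    ((expmx (s *: B) *m Q *m expmx (s *: B^T)) i j).

(* The Landau notations only accept filters with a canonical filter_on
   structure, which the library does not declare for +oo. *)
Canonical pinfty_nbhs_filter_on (R : realType) :=
  FilterType (pinfty_nbhs R) (@proper_pinfty_nbhs R).

(* Main.v *)
Require Import Defs.
From HB Require Import structures.
From mathcomp Require Import all_boot all_order all_algebra.
From mathcomp Require Import perm ring.
From mathcomp Require Import all_classical all_reals all_analysis.

Set Implicit Arguments.
Unset Strict Implicit.
Unset Printing Implicit Defensive.

Import Order.TTheory GRing.Theory Num.Theory.
Import numFieldNormedType.Exports.

Local Open Scope classical_set_scope.
Local Open Scope ring_scope.

(** Write [L X = B X + X B^T]. Since [B] is similar to a skew matrix [S], [L]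
is conjugate to the commutator with [S], which is skew for the Frobenius inner
product; hence [Q = M + L Y] with [L M = 0]. As [e^{sB} L(Y) e^{sB^T}] is the
derivative of [e^{sB} Y e^{sB^T}], which is bounded, the Gramian is
[t M + O(1)], and its determinant is [det M t^n + O(t^(n-1))].
The matrix [M] is positive semidefinite as a limit of Gramians divided by [t].
It is invertible: the orthogonal projection [P] onto the kernel of its
conjugate commutes with [S], so the trace of [P] against the conjugate of [Q]
vanishes; thus [Ker M] lies in [Ker Q], and it is [B^T]-invariant. *)

(** * The Frobenius norm and semidefinite forms *)

Lemma trmx_mul_eq0 (R : realDomainType) (m n : nat) (X : 'M[R]_(m, n)) :
  \tr (X *m X^T) = 0 -> X = 0.
Proof.
have -> : \tr (X *m X^T) = \sum_i \sum_j X i j ^+ 2.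
  apply: eq_bigr => i _; rewrite mxE.
  by apply: eq_bigr => j _; rewrite mxE expr2.
move=> /eqP; rewrite psumr_eq0; last first.
  by move=> i _; apply: sumr_ge0 => j _; exact: sqr_ge0.
move=> /allP X0; apply/matrixP => i j; rewrite mxE.
have /implyP/(_ isT) := X0 i (mem_index_enum i).
rewrite psumr_eq0; last by move=> k _; exact: sqr_ge0.
by move=> /allP/(_ j (mem_index_enum j)); rewrite /= sqrf_eq0 => /eqP.
Qed.

(** If [v K K^T = 0] then [v K] has zero norm. The inverse of [K K^T] enters the orthogonal
    projection onto the row space of [K]. *)
Lemma mulmx_tr_unit (R : realFieldType) (k n : nat) (K : 'M[R]_(k, n)) :
  row_free K -> K *m K^T \in unitmx.
Proof.
move=> fK; rewrite -row_free_unit; apply/inj_row_free => v vH.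
apply: (row_free_inj fK); rewrite mul0mx; apply: trmx_mul_eq0.
by rewrite trmx_mul mulmxA -[v *m K *m _]mulmxA vH mul0mx mxtrace0.
Qed.

Lemma quadratic_ge0_linear_eq0 (R : realFieldType) (a b : R) :
  0 <= a -> 0 <= b -> (forall c, 0 <= c ^+ 2 * b + 2 * c * a) -> a = 0.
Proof.
move=> a0 b0 Hc; apply/eqP; rewrite eq_le a0 andbT leNgt; apply/negP => agt.
(* The minimizer in [c] would be [- a / b]; the denominator [b + 1] also covers [b = 0] and still
   gives a negative value. *)
have := Hc (- a / (b + 1)).
have b1 : 0 < b + 1 by rewrite ltr_wpDl.
have -> : (- a / (b + 1)) ^+ 2 * b + 2 * (- a / (b + 1)) * a
    = - (a ^+ 2 * (b + 2) / (b + 1) ^+ 2) by field; rewrite gt_eqF.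
rewrite oppr_ge0 leNgt => /negP; apply.
by rewrite divr_gt0 ?mulr_gt0 ?exprn_gt0// ltr_wpDl.
Qed.

(** Here [x] minimizes the form of [Q], whose derivative at [x] in the direction [Q x] is twice the
    squared norm of [Q x]. *)
Lemma psdmx_ker (R : realType) (n : nat) (Q : 'M[R]_n) (x : 'cV[R]_n) :
  psdmx Q -> (x^T *m Q *m x) 0 0 = 0 -> Q *m x = 0.
Proof.
move=> [Qs Qp] x0.
pose y := Q *m x.
pose a : R := (y^T *m y) 0 0; pose b : R := (y^T *m Q *m y) 0 0.
have yT : y^T = x^T *m Q by rewrite trmx_mul Qs.
have a0 : 0 <= a.
  by rewrite /a mxE; apply: sumr_ge0 => i _; rewrite mxE -expr2 sqr_ge0.
have b0 : 0 <= b by exact: Qp.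
(* Test the form on [x + c y]. *)
have Hc c : 0 <= c ^+ 2 * b + 2 * c * a.
  have := Qp (x + c *: y).
  have -> : (x + c *: y)^T *m Q *m (x + c *: y) =
      x^T *m Q *m x + (2 * c) *: (y^T *m y) + (c ^+ 2) *: (y^T *m Q *m y).
    rewrite [(_ + _)^T]linearD /= [(_ *: _)^T]linearZ /= !mulmxDl !mulmxDr.
    rewrite -!scalemxAl -!scalemxAr scalerA -[y^T *m Q *m x]mulmxA -/y.
    by rewrite -yT expr2 mulr2n mulrDl mul1r scalerDl !addrA.
  rewrite mxE [X in X + _]mxE x0 add0r [X in X + _]mxE [X in _ + X]mxE.
  by rewrite -/a -/b addrC.
have a_eq0 := quadratic_ge0_linear_eq0 a0 b0 Hc.
apply: trmx_inj; rewrite trmx0; apply: trmx_mul_eq0.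
by rewrite trmxK -/y /mxtrace big_ord1 -/a a_eq0.
Qed.

(** * Commutators with a skew-symmetric matrix *)

(* The operator [X |-> S X - X S] is skew for the Frobenius inner product,
   hence its kernel and its image are complementary. *)
Lemma skew_commutator_decomp (R : realFieldType) (n : nat) (S Q : 'M[R]_n) :
  S^T = - S -> Q^T = Q ->
  exists M Y : 'M[R]_n,
    [/\ M^T = M, S *m M = M *m S & Q = M + (S *m Y - Y *m S)].
Proof.
move=> hS hQ.
pose f : 'End('M[R]_n) := linfun (mulmx S) - linfun (mulmxr S).
have fE X : f X = S *m X - X *m S by rewrite add_lfunE opp_lfunE !lfunE.
have disj : (lker f :&: limg f = 0)%VS.
  apply/eqP; rewrite -subv0; apply/subvP => X; rewrite memv_cap memv_ker fE.
  move=> /andP[/eqP SX /memv_imgP[Y _]]; rewrite fE => XE.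
  rewrite memv0; apply/eqP/trmx_mul_eq0.
  (* As [S] is skew, its commutant is stable under transposition; [X^T] commutes with [S], so the
     trace of [(S Y - Y S) X^T] vanishes by cyclicity. *)
  have SXT : S *m X^T = X^T *m S.
    apply: trmx_inj; rewrite !trmx_mul trmxK hS mulmxN mulNmx.
    by congr (- _); apply/esym/eqP; rewrite -subr_eq0 SX.
  rewrite {1}XE mulmxBl linearB /= -mulmxA -[Y *m S *m _]mulmxA SXT.
  by rewrite mxtrace_mulC -mulmxA subrr.
have full : (lker f + limg f = fullv)%VS.
  apply/eqP; rewrite eqEdim subvf dimv_disjoint_sum //=.
  by rewrite -(limg_ker_dim f fullv) capfv.
have /memv_addP[M0 kM0 [_ /memv_imgP[Y0 _ ->]]] : Q \in (lker f + limg f)%VS.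
  by rewrite full memvf.
rewrite fE => QE.
have SM0 : S *m M0 = M0 *m S.
  by move: kM0; rewrite memv_ker fE subr_eq0 => /eqP.
(* The commutator with [S] commutes with transposition, so for symmetric [Q] both components may be
   replaced by their symmetric parts. *)
pose sym (X : 'M[R]_n) := 2^-1 *: (X + X^T).
exists (sym M0), (sym Y0); split.
- by rewrite /sym linearZ /= linearD /= trmxK addrC.
- rewrite /sym -scalemxAl -scalemxAr mulmxDr mulmxDl SM0; congr (_ *: (_ + _)).
  by apply: trmx_inj; rewrite !trmx_mul trmxK hS mulmxN mulNmx SM0.
- have -> : Q = sym Q.
    by rewrite /sym hQ scalerDr -scalerDl -[2^-1]mul1r -splitr scale1r.
  rewrite {1}QE /sym.
  rewrite -scalemxAl -scalemxAr -scalerBr -scalerDr; congr (_ *: _).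
  rewrite [(_ + _)^T]linearD /= [(_ - _)^T]linearB /= !trmx_mul hS.
  rewrite mulmxN mulNmx.
  rewrite opprK [- _ + _]addrC addrACA [X in _ + X = _]addrACA -opprD.
  by rewrite mulmxDr mulmxDl.
Qed.

Lemma skew_commutator_ker (R : realType) (n : nat) (S Q M Y : 'M[R]_n)
    (z : 'cV[R]_n) :
  S^T = - S -> psdmx Q -> M^T = M -> S *m M = M *m S ->
  Q = M + (S *m Y - Y *m S) -> M *m z = 0 -> Q *m z = 0.
Proof.
move=> hS hQ hM SM QE Mz.
pose K := row_base (kermx M).
have fK : row_free K by exact: row_base_free.
have KM : K *m M = 0 by apply/sub_kermxP; rewrite eq_row_base.
(* Since [S] and [M] commute, the left kernel of [M], spanned by the rows of [K], is stable under
   [S]. *)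
have /submxP[A KS] : (K *m S <= K)%MS.
  rewrite eq_row_base; apply/sub_kermxP; rewrite -mulmxA SM mulmxA.
  by rewrite KM mul0mx.
have [w zE] : exists w, z^T = w *m K.
  apply/submxP; rewrite eq_row_base; apply/sub_kermxP.
  by rewrite -hM -trmx_mul Mz trmx0.
clearbody K.
have Hu : K *m K^T \in unitmx by exact: mulmx_tr_unit.
pose H := invmx (K *m K^T).
(* The orthogonal projection onto [Ker M]. *)
pose P := K^T *m H *m K.
have HT : H^T = H by rewrite /H trmx_inv trmx_mul trmxK.
have PT : P^T = P by rewrite /P trmx_mul trmx_mul trmxK HT mulmxA.
have KP : K *m P = K by rewrite /P !mulmxA mulmxV// mul1mx.
clearbody H.
have PP : P *m P = P by rewrite {1}/P -mulmxA KP.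
have PM : P *m M = 0 by rewrite /P -mulmxA KM mulmx0.
have PSP : P *m S = P *m S *m P.
  have -> : P *m S = K^T *m H *m A *m K by rewrite /P -mulmxA KS mulmxA.
  by rewrite -[RHS]mulmxA KP.
clearbody P.
(* Transposing [P S = P S P] with [S] skew gives [S P = P S P]. *)
have PS : P *m S = S *m P.
  have := congr1 trmx PSP.
  rewrite !trmx_mul PT hS mulNmx mulmxN => /oppr_inj ->.
  by rewrite PSP mulmxA.
have trQ : \tr (P *m Q) = 0.
  rewrite QE mulmxDr PM add0r mulmxBr linearB /= mulmxA PS -mulmxA.
  by rewrite mxtrace_mulC -mulmxA subrr.
(* The diagonal entries of [P Q P] are the values of the form of [Q] on the columns of [P]. Being
   nonnegative with zero sum they vanish, and [psdmx_ker] applies to each column. *)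
have QP : Q *m P = 0.
  have PQPii i : ((col i P)^T *m Q *m col i P) 0 0 = (P *m Q *m P) i i.
    rewrite tr_col PT -row_mul mxE [RHS]mxE.
    by apply: eq_bigr => k _; rewrite !mxE.
  have [_ Qp] := hQ.
  have : \tr (P *m Q *m P) = 0 by rewrite mxtrace_mulC mulmxA PP.
  move/eqP; rewrite psumr_eq0 => [/allP PQP0|i _]; last by rewrite -PQPii.
  apply/matrixP => k i.
  have := psdmx_ker hQ (_ : ((col i P)^T *m Q *m col i P) 0 0 = 0).
  rewrite PQPii; have /eqP -> := PQP0 i (mem_index_enum i).
  move=> /(_ erefl) QPi; transitivity ((Q *m col i P) k 0).
    by rewrite !mxE; apply: eq_bigr => l _; rewrite mxE.
  by rewrite QPi !mxE.
by rewrite -[z]trmxK zE -KP !trmx_mul PT !mulmxA QP !mul0mx.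
Qed.

(** * Determinants of positive matrices *)

Lemma posdef_det_neq0 (R : realType) (n : nat) (A : 'M[R]_n) :
  (forall x : 'cV[R]_n, x != 0 -> 0 < (x^T *m A *m x) 0 0) -> \det A != 0.
Proof.
move=> Ap; rewrite -unitfE -unitmxE -unitmx_tr -row_free_unit.
apply/inj_row_free => v vA; apply/eqP; rewrite -trmx_eq0.
apply/negP => /negP v0.
have := Ap _ v0; rewrite -mulmxA -[A *m _]trmxK trmx_mul trmxK vA.
by rewrite trmx0 mulmx0 mxE ltxx.
Qed.

(* The polynomial [u |-> det ((1 - u) M + u I)] has no root in [0, 1] and takes
   the value [1] at [1]. *)
Lemma det_psdmx_gt0 (R : realType) (n : nat) (M : 'M[R]_n) :
  (forall x : 'cV[R]_n, 0 <= (x^T *m M *m x) 0 0) -> M \in unitmx -> 0 < \det M.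
Proof.
move=> Mp Mu.
pose A : 'M[{poly R}]_n := (1 - 'X) *: map_mx polyC M + 'X%:M.
have Ae u : (\det A).[u] = \det ((1 - u) *: M + u%:M).
  rewrite -horner_evalE -det_map_mx; congr (\det _).
  apply/matrixP => i j; rewrite !mxE /= /horner_eval.
  by rewrite !(hornerE, hornerMn).
rewrite ltNge; apply/negP => det_le0.
have [u /andP[u0 u1]] : exists2 u, 0 <= u <= 1 & root (\det A) u.
  apply: poly_ivt => //; rewrite !Ae subr0 scale1r raddf0 addr0 det_le0.
  by rewrite subrr scale0r add0r det1 ler01.
rewrite rootE Ae; apply/negP.
(* At [u = 0] the matrix is the invertible [M]; for [u > 0] the term [u I] makes it positive
   definite. *)
move: u0; rewrite le_eqVlt => /predU1P[<-|u0].
  by rewrite subr0 scale1r raddf0 addr0 -unitfE -unitmxE.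
apply: posdef_det_neq0 => x x0.
rewrite mulmxDr mulmxDl -scalemxAr -scalemxAl mul_mx_scalar -scalemxAl.
rewrite mxE ltr_wpDl //; first by rewrite mxE mulr_ge0// subr_ge0.
rewrite mxE mulr_gt0// lt_neqAle; apply/andP; split.
  apply: contra x0 => /eqP xx; rewrite -trmx_eq0; apply/eqP/trmx_mul_eq0.
  by rewrite trmxK /mxtrace big_ord1 -xx.
by rewrite mxE; apply: sumr_ge0 => i _; rewrite mxE -expr2 sqr_ge0.
Qed.

(** * The matrix exponential as an entrywise power series *)

Lemma limn_mxE (R : realType) (m n : nat) (f : nat -> 'M[R]_(m, n)) i j :
  (forall i j, cvgn (fun k => f k i j)) ->
  limn f i j = limn (fun k => f k i j).
Proof.
move=> fcvg.
have /cvg_lim -> // : f @ \oo --> \matrix_(i, j) limn (fun k => f k i j).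
  move=> A [P Pn PA].
  have Pf : \forall k \near \oo, forall a b, P a b (f k a b).
    apply: filter_forall => a; apply: filter_forall => b.
    by have := Pn a b; rewrite mxE; exact: fcvg.
  by apply: filterS Pf => k Pk; exact: PA.
by rewrite mxE.
Qed.

(** The sum [C] of all absolute values dominates each absolute row sum of [B], which bounds the
    factor gained at each multiplication by [B]. *)
Lemma expr_mx_entry_bound (R : realType) (n : nat) (B : 'M[R]_n) k i j :
  `|(B ^+ k) i j| <= (\sum_a \sum_b `|B a b|) ^+ k.
Proof.
set C := \sum_a _.
have C0 : 0 <= C by apply: sumr_ge0 => a _; exact: sumr_ge0.
elim: k i j => [|k IH] i j.
  by rewrite !expr0 mxE; case: eqP; rewrite ?normr1 ?normr0.
rewrite !exprS mxE (le_trans (ler_norm_sum _ _ _))//.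
rewrite (@le_trans _ _ (\sum_l `|B i l| * C ^+ k))//.
  by apply: ler_sum => l _; rewrite normrM ler_wpM2l.
rewrite -mulr_suml ler_wpM2r ?exprn_ge0// /C [leRHS](bigD1 i)//= lerDl.
by apply: sumr_ge0 => a _; exact: sumr_ge0.
Qed.

(** Coefficients of the series in [s] of the [(i, j)] entry of [e^{sB} B^m]. The shift [m] makes the
    family closed under formal differentiation, which raises [m] by one. *)
Definition expmx_coeff (R : realType) (n : nat) (B : 'M[R]_n) (m : nat)
  (i j : 'I_n) (k : nat) : R := (k`!%:R)^-1 * (B ^+ (k + m)) i j.

(** The series is dominated by [C ^ m] times the exponential series at [C |s|], with [C] the sum of
    the absolute values of the entries of [B]. *)
Lemma cvg_expmx_coeff (R : realType) (n : nat) (B : 'M[R]_n) m i j (s : R) :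
  cvgn (pseries (expmx_coeff B m i j) s).
Proof.
pose C := \sum_a \sum_b `|B a b|.
have C0 : 0 <= C by apply: sumr_ge0 => a _; exact: sumr_ge0.
apply: normed_cvg.
apply: (@series_le_cvg _ _ (C ^+ m *: exp_coeff (C * `|s|))) => [k|k|k|].
- exact: normr_ge0.
- rewrite /exp_coeff /=; apply: mulr_ge0; first exact: exprn_ge0.
  by rewrite divr_ge0// exprn_ge0// mulr_ge0.
- rewrite /expmx_coeff /exp_coeff /= 2!normrM normfV normr_nat normrX.
  rewrite -[leRHS]/(C ^+ m * ((C * `|s|) ^+ k / k`!%:R)).
  have -> : C ^+ m * ((C * `|s|) ^+ k / k`!%:R) =
      k`!%:R^-1 * (C ^+ (k + m) * `|s| ^+ k) by rewrite exprMn exprD; ring.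
  rewrite -mulrA ler_wpM2l ?invr_ge0// ler_wpM2r ?exprn_ge0//.
  exact: expr_mx_entry_bound.
- by apply: is_cvg_seriesZ; exact: is_cvg_series_exp_coeff.
Qed.

Lemma scale_expr_mx (R : comRingType) (n : nat) (s : R) (B : 'M[R]_n) k :
  (s *: B) ^+ k = s ^+ k *: B ^+ k.
Proof.
elim: k => [|k IH]; first by rewrite !expr0 scale1r.
by rewrite !exprS IH -mulmxE -scalemxAl -scalemxAr scalerA.
Qed.

Lemma expmx_scaleE (R : realType) (n : nat) (B : 'M[R]_n) (s : R) i j :
  expmx (s *: B) i j = limn (pseries (expmx_coeff B 0 i j) s).
Proof.
have E a b : (fun N => series (fun k => (k`!%:R)^-1 *: (s *: B) ^+ k) N a b) =
    pseries (expmx_coeff B 0 a b) s.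
  apply/funext => N; rewrite /pseries /series /= summxE.
  apply: eq_bigr => k _; rewrite scale_expr_mx !mxE /expmx_coeff addn0.
  by rewrite [s ^+ k * _]mulrC mulrA.
rewrite /expmx limn_mxE ?E // => a b; rewrite E; exact: cvg_expmx_coeff.
Qed.

Lemma expmx_tr (R : realType) (n : nat) (B : 'M[R]_n) (s : R) :
  expmx (s *: B^T) = (expmx (s *: B))^T.
Proof.
apply/matrixP => i j; rewrite mxE !expmx_scaleE; congr (limn (pseries _ s)).
apply/funext => k; rewrite /expmx_coeff; congr (_ * _).
have -> : B^T ^+ (k + 0) = (B ^+ (k + 0))^T; last by rewrite mxE.
elim: (k + 0)%N => [|l IH]; first by rewrite !expr0 trmx1.
by rewrite exprS exprSr -!mulmxE trmx_mul IH.
Qed.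

Lemma expmx0 (R : realType) (n : nat) (B : 'M[R]_n) : expmx (0 *: B) = 1%:M.
Proof.
apply/matrixP => i j; rewrite expmx_scaleE; apply: lim_near_cst => //.
(* The partial sum must be nonempty to contain the term of index [0], the only one that survives at
   [s = 0]. *)
near=> N; rewrite /pseries /series /= -[N]prednK; last first.
  by near: N; exact: nbhs_infty_gt.
rewrite big_nat_recl//= big1 ?addr0 => [|k _]; last by rewrite expr0n mulr0.
by rewrite /expmx_coeff fact0 invr1 mul1r expr0 mulr1.
Unshelve. all: by end_near. Qed.

Lemma is_derive_expmx (R : realType) (n : nat) (B : 'M[R]_n) (s : R) i j :
  is_derive s (1 : R) (fun s => expmx (s *: B) i j)
    ((expmx (s *: B) *m B) i j).
Proof.
have diffs m : pseries_diffs (expmx_coeff B m i j) = expmx_coeff B m.+1 i j.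
  apply/funext => k; rewrite /pseries_diffs /expmx_coeff factS natrM.
  by rewrite invfM mulrA addSnnS mulVKf.
have -> : (fun s => expmx (s *: B) i j) =
    (fun s => limn (pseries (expmx_coeff B 0 i j) s)).
  by apply/funext => u; rewrite expmx_scaleE.
have -> : (expmx (s *: B) *m B) i j =
    limn (pseries (pseries_diffs (expmx_coeff B 0 i j)) s).
  rewrite diffs mxE; apply/esym/cvg_lim => //.
  have -> : pseries (expmx_coeff B 1 i j) s =
     (fun N => \sum_l pseries (expmx_coeff B 0 i l) s N * B l j).
    apply/funext => N; rewrite /pseries /series /=.
    under [RHS]eq_bigr do rewrite mulr_suml.
    rewrite exchange_big /=; apply: eq_bigr => k _.
    rewrite /expmx_coeff addn1 exprSr -mulmxE mxE mulr_sumr mulr_suml.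
    by apply: eq_bigr => l _; rewrite addn0; ring.
  apply: cvg_big => [|l _]; first exact: add_continuous.
  apply: cvgMr_tmp.
  rewrite expmx_scaleE; exact: cvg_expmx_coeff.
(* Termwise differentiation holds strictly inside a radius of convergence; any radius larger than
   [|s|] will do. *)
apply: (@pseries_snd_diffs _ _ (`|s| + 1)); rewrite ?diffs.
1-3: exact: cvg_expmx_coeff.
by rewrite [ltRHS]ger0_norm ?ltrDl// addr_ge0.
Qed.

(** * Entrywise calculus and the flow *)

Definition is_derive_mx (R : realType) (m n : nat) (s : R)
    (F : R -> 'M[R]_(m, n)) (dF : 'M[R]_(m, n)) : Prop :=
  forall i j, is_derive s (1 : R) (fun u => F u i j) (dF i j).

Lemma is_derive_mx_cst (R : realType) (m n : nat) (s : R) (A : 'M[R]_(m, n)) :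
  is_derive_mx s (fun=> A) 0.
Proof. by move=> i j; rewrite mxE; exact: is_derive_cst. Qed.

Lemma is_derive_mxD (R : realType) (m n : nat) (s : R)
    (F G : R -> 'M[R]_(m, n)) dF dG :
  is_derive_mx s F dF -> is_derive_mx s G dG ->
  is_derive_mx s (fun u => F u + G u) (dF + dG).
Proof.
move=> hF hG i j; rewrite mxE.
have -> : (fun u => (F u + G u) i j) = (fun u => F u i j) + (fun u => G u i j).
  by apply/funext => u; rewrite mxE.
exact: is_deriveD.
Qed.

Lemma is_derive_mxM (R : realType) (m n p : nat) (s : R)
    (F : R -> 'M[R]_(m, n)) (G : R -> 'M[R]_(n, p)) dF dG :
  is_derive_mx s F dF -> is_derive_mx s G dG ->
  is_derive_mx s (fun u => F u *m G u) (dF *m G s + F s *m dG).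
Proof.
move=> hF hG i j.
have -> : (fun u => (F u *m G u) i j) =
    \sum_(l < n) ((fun u => F u i l) * (fun u => G u l j)).
  by apply/funext => u; rewrite mxE fct_sumE.
have -> : (dF *m G s + F s *m dG) i j =
    \sum_(l < n) (F s i l *: dG l j + G s l j *: dF i l).
  rewrite !mxE -big_split /=; apply: eq_bigr => l _.
  by rewrite addrC [dF i l * _]mulrC.
by apply: is_derive_sum => l; exact: is_deriveM.
Qed.

Lemma is_derive_mx_tr (R : realType) (m n : nat) (s : R)
    (F : R -> 'M[R]_(m, n)) dF :
  is_derive_mx s F dF -> is_derive_mx s (fun u => (F u)^T) dF^T.
Proof.
move=> hF i j; rewrite mxE.
have -> : (fun u => (F u)^T i j) = (fun u => F u j i).
  by apply/funext => u; rewrite mxE.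
exact: hF.
Qed.

Lemma is_derive_mx_idZ (R : realType) (m n : nat) (s : R) (A : 'M[R]_(m, n)) :
  is_derive_mx s (fun u => u *: A) A.
Proof.
move=> i j.
have -> : (fun u : R => (u *: A) i j) = id * cst (A i j).
  by apply/funext => u; rewrite mxE.
by apply: is_derive_eq; rewrite scaler0 add0r [_ *: _]mulr1.
Qed.

(* [X |-> e^{sB} X e^{sB^T}] is the flow of [X' = B X + X B^T]. *)
Lemma is_derive_congruence (R : realType) (n : nat) (B X : 'M[R]_n) (s : R) :
  is_derive_mx s (fun u => expmx (u *: B) *m X *m (expmx (u *: B))^T)
    (expmx (s *: B) *m (B *m X + X *m B^T) *m (expmx (s *: B))^T).
Proof.
have hE : is_derive_mx s (fun u => expmx (u *: B)) (expmx (s *: B) *m B).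
  by move=> i j; exact: is_derive_expmx.
have := is_derive_mxM (is_derive_mxM hE (is_derive_mx_cst s X))
  (is_derive_mx_tr hE).
by rewrite mulmx0 addr0 trmx_mul mulmxDr mulmxDl !mulmxA.
Qed.

(** Such an [X] is an equilibrium of the flow: the derivative vanishes and the value at [0] is
    [X]. *)
Lemma congruence_cst (R : realType) (n : nat) (B X : 'M[R]_n) (s : R) :
  B *m X + X *m B^T = 0 -> expmx (s *: B) *m X *m (expmx (s *: B))^T = X.
Proof.
move=> BX; apply/matrixP => i j.
pose f u := (expmx (u *: B) *m X *m (expmx (u *: B))^T) i j.
have -> : X i j = f 0 by rewrite /f expmx0 trmx1 mul1mx mulmx1.
apply: (@is_derive_0_is_cst _ f) => u.
by have := is_derive_congruence B X u i j; rewrite BX mulmx0 mul0mx mxE.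
Qed.

(** * Closed form and positivity of the Gramian *)

(** In the integrand, the part from [M] is constant and the part from [Y] is an exact derivative.
    Subtracting [Y] makes the primitive vanish at [0]. *)
Lemma is_derive_gramian_primitive (R : realType) (n : nat) (Q B M Y : 'M[R]_n)
    (u : R) :
  B *m M + M *m B^T = 0 -> Q = M + (B *m Y + Y *m B^T) ->
  is_derive_mx u
    (fun t => t *: M + (expmx (t *: B) *m Y *m (expmx (t *: B))^T - Y))
    (expmx (u *: B) *m Q *m (expmx (u *: B))^T).
Proof.
move=> BM ->; rewrite [X in X *m _]mulmxDr [X in is_derive_mx _ _ X]mulmxDl.
rewrite congruence_cst// -[X in _ + X]addr0.
apply: is_derive_mxD; first exact: is_derive_mx_idZ.
by apply: is_derive_mxD; [exact: is_derive_congruence|exact: is_derive_mx_cst].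
Qed.

Lemma gramianE (R : realType) (n : nat) (Q B M Y : 'M[R]_n) (t : R) :
  B *m M + M *m B^T = 0 -> Q = M + (B *m Y + Y *m B^T) -> 0 < t ->
  gramian Q B t =
  t *: M + (expmx (t *: B) *m Y *m (expmx (t *: B))^T - Y).
Proof.
move=> BM QE t0.
pose H u := u *: M + (expmx (u *: B) *m Y *m (expmx (u *: B))^T - Y).
have dH u : is_derive_mx u H _ := is_derive_gramian_primitive u BM QE.
apply/matrixP => i j; rewrite mxE.
have -> : (fun s => (expmx (s *: B) *m Q *m expmx (s *: B^T)) i j) =
    (fun s => (expmx (s *: B) *m Q *m (expmx (s *: B))^T) i j).
  by apply/funext => s; rewrite expmx_tr.
have cont (F : R -> R) : (forall u, derivable F u 1) -> continuous F.
  by move=> dF u; apply/differentiable_continuous/derivable1_diffP.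
have dHij u : derivable (fun s => H s i j) u 1 by have [] := dH u i j.
have cH := cont _ dHij.
rewrite /Rintegral (continuous_FTC2 (F := fun s => H s i j) t0).
- have H0 : H 0 = 0.
    by rewrite /H expmx0 trmx1 mul1mx mulmx1 scale0r subrr addr0.
  by rewrite -EFinB /= H0 [X in _ - X]mxE subr0.
- apply: continuous_subspaceT; apply: cont => u.
  by have [] := is_derive_congruence B Q u i j.
- split=> //.
  + by apply: cvg_at_right_filter; exact: cH.
  + by apply: cvg_at_left_filter; exact: cH.
- by move=> u _; rewrite derive1E; have [_ ] := dH u i j.
Qed.

(** The form of the primitive at [x] starts from [0] and is nondecreasing: its derivative at [u] is
    the form of [Q] at [e^{uB^T} x]. *)
Lemma gramian_psd (R : realType) (n : nat) (Q B M Y : 'M[R]_n)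
    (x : 'cV[R]_n) (t : R) :
  B *m M + M *m B^T = 0 -> Q = M + (B *m Y + Y *m B^T) -> psdmx Q -> 0 < t ->
  0 <= (x^T *m gramian Q B t *m x) 0 0.
Proof.
move=> BM QE [_ Qp] t0; rewrite (gramianE BM QE t0).
pose H u := u *: M + (expmx (u *: B) *m Y *m (expmx (u *: B))^T - Y).
have dH u : is_derive_mx u H _ := is_derive_gramian_primitive u BM QE.
pose phi u : R := (x^T *m H u *m x) 0 0.
pose dphi u : R :=
  (x^T *m (expmx (u *: B) *m Q *m (expmx (u *: B))^T) *m x) 0 0.
have phiE u : is_derive u (1 : R) phi (dphi u).
  have := is_derive_mxM (is_derive_mxM (is_derive_mx_cst u x^T) (dH u))
    (is_derive_mx_cst u x).
  by rewrite mul0mx add0r mulmx0 addr0 => /(_ 0 0).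
have <- : phi 0 = 0.
  rewrite /phi /H expmx0 trmx1 mul1mx mulmx1 scale0r subrr addr0 mulmx0.
  by rewrite mul0mx mxE.
rewrite -[leRHS]/(phi t).
apply: (@ger0_derive1_ndecr _ phi 0 t) => //; last by rewrite ltW.
- move=> u _; rewrite derive1E; have [_ ->] := phiE u.
  have := Qp ((expmx (u *: B))^T *m x).
  by rewrite trmx_mul trmxK /dphi !mulmxA.
- apply: continuous_subspaceT => u.
  by apply/differentiable_continuous/derivable1_diffP; have [] := phiE u.
Qed.

(** * Bounded matrix functions *)

Definition bounded_mx (R : realType) (T : Type) (m n : nat)
    (F : T -> 'M[R]_(m, n)) : Prop :=
  exists C, forall x i j, `|F x i j| <= C.

Lemma bounded_mx_cst (R : realType) (T : Type) (m n : nat) (A : 'M[R]_(m, n)) :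
  bounded_mx (fun _ : T => A).
Proof.
exists (\sum_i \sum_j `|A i j|) => _ i j.
rewrite (bigD1 i)//= (bigD1 j)//= -addrA lerDl.
by rewrite addr_ge0//; do ?[apply: sumr_ge0 => ? _].
Qed.

Lemma bounded_mxD (R : realType) (T : Type) (m n : nat)
    (F G : T -> 'M[R]_(m, n)) :
  bounded_mx F -> bounded_mx G -> bounded_mx (fun x => F x + G x).
Proof.
move=> [C FC] [D GD]; exists (C + D) => x i j; rewrite mxE.
by rewrite (le_trans (ler_normD _ _))// lerD.
Qed.

Lemma bounded_mxM (R : realType) (T : Type) (m n p : nat)
    (F : T -> 'M[R]_(m, n)) (G : T -> 'M[R]_(n, p)) :
  bounded_mx F -> bounded_mx G -> bounded_mx (fun x => F x *m G x).
Proof.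
move=> [C FC] [D GD]; exists (\sum_(l < n) C * D) => x i j; rewrite mxE.
rewrite (le_trans (ler_norm_sum _ _ _))//; apply: ler_sum => l _.
by rewrite normrM ler_pM.
Qed.

Lemma bounded_mx_tr (R : realType) (T : Type) (m n : nat)
    (F : T -> 'M[R]_(m, n)) :
  bounded_mx F -> bounded_mx (fun x => (F x)^T).
Proof. by move=> [C FC]; exists C => x i j; rewrite mxE. Qed.

(** The rows of an orthogonal matrix have unit norm, so no entry exceeds [1] in absolute value. *)
Lemma bounded_mx_orthogonal (R : realType) (T : Type) (n : nat)
    (F : T -> 'M[R]_n) :
  (forall x, F x *m (F x)^T = 1%:M) -> bounded_mx F.
Proof.
move=> F1; exists 1 => x i j.
have := congr1 (fun A : 'M[R]_n => A i i) (F1 x); rewrite !mxE eqxx mulr1n.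
under eq_bigr do rewrite mxE -expr2.
rewrite -(@ler_pXn2r _ 2) ?nnegrE// real_normK ?num_real// expr1n => <-.
by rewrite (bigD1 j)//= lerDl sumr_ge0// => k _; exact: sqr_ge0.
Qed.

Lemma bounded_expmx (R : realType) (n : nat) (B S P : 'M[R]_n) :
  S^T = - S -> P \in unitmx -> P *m B = S *m P ->
  bounded_mx (fun s => expmx (s *: B)).
Proof.
move=> hS Pu PB.
have BE : B = invmx P *m S *m P by rewrite -mulmxA -PB mulKmx.
(* [X] is invariant under the flow, so [P e^{sB} P^-1] is orthogonal. *)
pose X := invmx P *m (invmx P)^T.
have BX : B *m X + X *m B^T = 0.
  rewrite /X BE !trmx_mul hS -!mulmxA (mulmxA P) mulmxV// mul1mx.
  rewrite (mulmxA (invmx P)^T) -trmx_mul mulmxV// trmx1 mul1mx.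
  by rewrite mulNmx !mulmxN subrr.
pose W s := P *m expmx (s *: B) *m invmx P.
have bW : bounded_mx W.
  apply: bounded_mx_orthogonal => s; rewrite /W.
  have := congruence_cst s BX => /(congr1 (fun A => P *m A *m P^T)).
  rewrite /X !trmx_mul !mulmxA mulmxV// mul1mx => ->.
  by rewrite -trmx_mul mulmxV// trmx1.
have -> : (fun s => expmx (s *: B)) = (fun s => invmx P *m W s *m P).
  by apply/funext => s; rewrite /W !mulmxA mulVmx// mul1mx mulmxKV.
by do ![apply: bounded_mxM => //]; exact: bounded_mx_cst.
Qed.

(** * Leading term of the determinant of [t M + N t] *)

(** In the expanded product only one term has degree [k] in [t]. The constant depends on [k] and [C]
    alone, so it serves all permutations of a determinant at once. *)
Lemma prod_affine_bound (R : realType) (k : nat) (C : R) : 0 <= C ->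
  exists2 K, 0 <= K &
    forall (I : Type) (r : seq I) (a b : I -> R) (t : R),
    size r = k -> 1 <= t ->
    (forall i, `|a i| <= C) -> (forall i, `|b i| <= C) ->
    `|\prod_(i <- r) (t * a i + b i) - t ^+ k * \prod_(i <- r) a i|
      <= K * t ^+ k.-1.
Proof.
move=> C0.
(* Multiplying by [t] removes the truncated predecessor [k.-1] from the induction; for [k = 0] the
   difference is zero. *)
suff [K K0 hK] : exists2 K, 0 <= K &
    forall (I : Type) (r : seq I) (a b : I -> R) (t : R),
    size r = k -> 1 <= t ->
    (forall i, `|a i| <= C) -> (forall i, `|b i| <= C) ->
    `|\prod_(i <- r) (t * a i + b i) - t ^+ k * \prod_(i <- r) a i| * t
      <= K * t ^+ k.
  exists K => // I r a b t rk t1 aC bC.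
  have t0 : 0 < t by exact: lt_le_trans t1.
  case: k rk hK => [/size0nil ->|k rk] hK.
    by rewrite !big_nil !expr0 !mul1r subrr normr0 mulr1.
  by rewrite -(ler_pM2r t0) -mulrA -exprSr; exact: hK.
elim: k => [|k [K K0 IH]].
  exists 0 => // I r a b t /size0nil -> _ _ _.
  by rewrite !big_nil !expr0 !mul1r subrr normr0 !mul0r.
(* After one factor is split off, the affine factor is at most [2 C t], whence [2 C K], and the
   remaining [b i] times [A] is at most [C ^ k.+1]. *)
exists (2 * C * K + C ^+ k.+1) => [|I [//|i r] a b t [rk] t1 aC bC].
  by rewrite addr_ge0 ?mulr_ge0 ?exprn_ge0.
have t0 : 0 < t by exact: lt_le_trans t1.
rewrite !big_cons; set p := \prod_(_ <- _) (_ + _); set A := \prod_(_ <- _) _.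
have -> : (t * a i + b i) * p - t ^+ k.+1 * (a i * A) =
   (t * a i + b i) * (p - t ^+ k * A) + b i * (t ^+ k * A).
  by rewrite exprS; ring.
have AC : `|A| <= C ^+ k.
  rewrite normr_prod -rk; elim: {rk p A} r => [|j r IHr] /=.
    by rewrite big_nil expr0.
  by rewrite big_cons exprS ler_pM// prodr_ge0.
have -> : (2 * C * K + C ^+ k.+1) * t ^+ k.+1 =
    2 * C * t * (K * t ^+ k) + C * (t ^+ k * C ^+ k) * t.
  by rewrite !exprS; ring.
apply: le_trans (ler_wpM2r (ltW t0) (ler_normD _ _)) _.
rewrite mulrDl; apply: lerD.
  rewrite normrM -mulrA; apply: ler_pM => //; last exact: IH.
    by rewrite mulr_ge0// ltW.
  rewrite (le_trans (ler_normD _ _))// normrM (gtr0_norm t0) -mulrA.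
  rewrite mulr2n mulrDl mul1r.
  apply: lerD; first by rewrite [C * t]mulrC ler_wpM2l// ltW.
  by rewrite (le_trans (bC i))// ler_peMr.
have tk0 : 0 <= t ^+ k by rewrite exprn_ge0// ltW.
rewrite (ler_wpM2r (ltW t0))// !normrM (ger0_norm tk0).
by rewrite ler_pM ?mulr_ge0// ler_wpM2l.
Qed.

Lemma det_affine_bound (R : realType) (n : nat) (M : 'M[R]_n)
    (N : R -> 'M[R]_n) :
  bounded_mx N ->
  exists K, forall t, 1 <= t ->
    `|\det (t *: M + N t) - \det M * t ^+ n| <= K * t ^+ n.-1.
Proof.
move=> [D ND]; have [C MC] := bounded_mx_cst unit M.
(* The absolute values make the common bound nonnegative even for [n = 0], when no entry forces [C]
   or [D] to be so. *)
have [K K0 hK] := prod_affine_bound n (normr_ge0 (`|C| + `|D|)).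
exists (\sum_(s : 'S_n) K) => t t1.
rewrite /determinant mulr_suml -sumrB mulr_suml.
rewrite (le_trans (ler_norm_sum _ _ _))//; apply: ler_sum => s _.
rewrite -mulrA -mulrBr normrM normrX normrN1 expr1n mul1r.
under eq_bigr do rewrite 2!mxE.
rewrite [X in _ - X]mulrC; apply: hK => //.
- by rewrite -[index_enum _]enumT -cardE card_ord.
- move=> i; rewrite [leRHS]ger0_norm ?addr_ge0// (le_trans (MC tt _ _))//.
  by rewrite (le_trans (ler_norm C))// lerDl.
- move=> i; rewrite [leRHS]ger0_norm ?addr_ge0// (le_trans (ND t _ _))//.
  by rewrite (le_trans (ler_norm D))// lerDr.
Qed.

(** * Decomposition of [Q] and growth of the determinant *)

Lemma lyapunov_decomp_unit (R : realType) (n : nat) (Q B S P : 'M[R]_n) :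
  psdmx Q -> ker_no_invariant Q B -> S^T = - S -> P \in unitmx ->
  P *m B = S *m P ->
  exists M Y, [/\ B *m M + M *m B^T = 0, Q = M + (B *m Y + Y *m B^T) &
    M \in unitmx].
Proof.
move=> hQ hker hS Pu PB; have [Qs Qp] := hQ.
have hQ' : psdmx (P *m Q *m P^T).
  split=> [|x]; first by rewrite !trmx_mul trmxK Qs mulmxA.
  by have := Qp (P^T *m x); rewrite trmx_mul trmxK !mulmxA.
have [M' [Y' [Ms SM QE]]] := skew_commutator_decomp hS (proj1 hQ').
have BE : B = invmx P *m S *m P by rewrite -mulmxA -PB mulKmx.
have BTE : B^T = - (P^T *m S *m (invmx P)^T).
  by rewrite BE !trmx_mul hS mulNmx mulmxN mulmxA.
have PV : (invmx P)^T *m P^T = 1%:M by rewrite -trmx_mul mulmxV// trmx1.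
have PV' : P^T *m (invmx P)^T = 1%:M by rewrite -trmx_mul mulVmx// trmx1.
(* This congruence intertwines the commutator with [S] and the operator [L]. *)
pose conj X := invmx P *m X *m (invmx P)^T.
have Bconj X : B *m conj X + conj X *m B^T = conj (S *m X - X *m S).
  rewrite BTE BE mulmxN /conj mulmxBr mulmxBl -!mulmxA (mulmxA P).
  rewrite mulmxV// mul1mx.
  by rewrite (mulmxA (invmx P)^T P^T) PV mul1mx.
have QconjE : Q = conj (P *m Q *m P^T).
  by rewrite /conj -!mulmxA PV' mulmx1 mulKmx.
have BM : B *m conj M' + conj M' *m B^T = 0.
  by rewrite Bconj SM subrr /conj mulmx0 mul0mx.
exists (conj M'), (conj Y'); split=> //.
  by rewrite Bconj {1}QconjE QE /conj mulmxDr mulmxDl.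
have Mcs : (conj M')^T = conj M' by rewrite /conj !trmx_mul trmxK Ms mulmxA.
pose W := lker (linfun (mulmx (conj M')) : 'Hom('cV[R]_n, 'cV[R]_n)).
have memW x : (x \in W) = (conj M' *m x == 0) by rewrite memv_ker lfunE.
have W0 : W = 0%VS.
  apply: hker => x; rewrite memW => /eqP Mx; last first.
    (* Since [M B^T = - B M], the kernel of [M] is stable under [B^T]. *)
    have /eqP := BM; rewrite addrC addr_eq0 => /eqP MB.
    by rewrite memW mulmxA MB mulNmx -mulmxA Mx mulmx0 oppr0.
  have := skew_commutator_ker hS hQ' Ms SM QE (z := (invmx P)^T *m x).
  rewrite -!mulmxA (mulmxA P^T) PV' mul1mx.
  have -> : M' *m ((invmx P)^T *m x) = P *m (conj M' *m x).
    by rewrite /conj !mulmxA mulmxV// mul1mx.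
  rewrite Mx mulmx0 => /(_ erefl) /(congr1 (mulmx (invmx P))).
  by rewrite mulKmx// mulmx0.
rewrite -unitmx_tr -row_free_unit; apply/inj_row_free => v vM.
apply: trmx_inj; rewrite trmx0; apply/eqP; rewrite -memv0 -W0 memW.
by apply/eqP/trmx_inj; rewrite trmx_mul trmxK vM trmx0.
Qed.

Theorem mainTheorem5 (R : realType) (n : nat) (Q B : 'M[R]_n)
    (nu : nat) (p : 'I_nu.+1 -> nat) (e : n = (\sum_k p k)%N)
    (hn : (2 <= n)%N)
    (hQ : psdmx Q)
    (hker : ker_no_invariant Q B)
    (hcan : canonical_form e Q B)
    (hrank : (\rank Q < n)%N)
    (hskew : exists2 S : 'M[R]_n, S^T = - S & simmx_in unitmx B S) :
  exists2 gamma : R, 0 < gamma &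
    (fun t : R => \det (gramian Q B t)) =
      (fun t : R => gamma * t ^+ n) +O_ (+oo_R) (fun t : R => t ^+ n.-1).
Proof.
have [S hS [P Pu /(simmxP Pu) PB]] := hskew.
have [M [Y [BM QE Mu]]] := lyapunov_decomp_unit hQ hker hS Pu PB.
pose N t := expmx (t *: B) *m Y *m (expmx (t *: B))^T - Y.
have bN : bounded_mx N.
  have bE := bounded_expmx hS Pu PB.
  apply: bounded_mxD; last exact: bounded_mx_cst.
  apply: bounded_mxM; last exact: bounded_mx_tr.
  by apply: bounded_mxM => //; exact: bounded_mx_cst.
exists (\det M).
  apply: det_psdmx_gt0 => // x.
  have [C NC] : bounded_mx (fun t => x^T *m N t *m x).
    by do ![apply: bounded_mxM => //]; exact: bounded_mx_cst.
  rewrite leNgt; apply/negP => xMx.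
  (* If the form of [M] were negative at [x], this [t] would make its contribution [- (|C| + 1)].
     The bounded term, at most [|C|], cannot offset it, so the form of the Gramian would be
     negative. *)
  pose t := (`|C| + 1) / - (x^T *m M *m x) 0 0.
  have t0 : 0 < t by rewrite divr_gt0 ?oppr_gt0// ltr_wpDl.
  have := gramian_psd x BM QE hQ t0.
  rewrite (gramianE BM QE t0) mulmxDr mulmxDl -scalemxAr -scalemxAl.
  rewrite mxE [X in X + _]mxE.
  rewrite -/(N t) leNgt => /negP; apply.
  have -> : t * (x^T *m M *m x) 0 0 = - (`|C| + 1).
    by rewrite /t invrN mulrN mulNr divfK// lt_eqF.
  rewrite addrC subr_lt0 (le_lt_trans (ler_norm _))//.
  rewrite (le_lt_trans (NC _ _ _))//.
  by rewrite (le_lt_trans (ler_norm _))// ltrDl.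
have [K hK] := det_affine_bound M bN.
(* Every constant above [K] witnesses the estimate, as soon as [t >= 1]. *)
apply/eqaddOP; exists K; split; first exact: num_real.
move=> k Kk; near=> t.
have t1 : 1 <= t by near: t; apply: nbhs_pinfty_ge; exact: num_real.
have t0 : 0 < t by exact: lt_le_trans t1.
rewrite -[leLHS]/(`|\det (gramian Q B t) - \det M * t ^+ n|).
have tn0 : 0 <= t ^+ n.-1 by rewrite exprn_ge0// ltW.
rewrite (gramianE BM QE t0) (le_trans (hK t t1))// (ger0_norm tn0).
by rewrite ler_wpM2r// ltW.
Unshelve. all: by end_near. Qed.
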